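(* If the $K$ arms follow Gaussian distributions with identical variance $\sigma^2$ and $w_a>0$ for all $a$, then for any neighbor $\boldsymbol\pi'\in\mathcal V_{\mathcal F}(\boldsymbol\pi^* )$ the projection $$\min_{\boldsymbol\lambda\in\mathcal D:\ \boldsymbol\lambda^\top(\boldsymbol\pi^*-\boldsymbol\pi')\le 0}\ \sum_{a=1}^K w_a\, d(\mu_a,\lambda_a)$$ is attained by $$\lambda_{a,\boldsymbol\pi'}=\mu_a-\gamma\,\frac{(\boldsymbol\pi^*-\boldsymbol\pi')_a}{w_a},\qquad \gamma=\frac{\boldsymbol\mu^\top(\boldsymbol\pi^*-\boldsymbol\pi')}{\sum_{b=1}^K \frac{(\boldsymbol\pi^*-\boldsymbol\pi')_b^2}{w_b}},$$ and the characteristic time is given by $$T_{\mathcal F}(\boldsymbol\mu)^{-1}=\max_{\boldsymbol w\in\Pi}\ \min_{\boldsymbol\pi'\in\mathcal V_{\mathcal F}(\boldsymbol\pi^* )}\ \frac1{2\sigma^2}\,\frac{\big(\boldsymbol\mu^\top(\boldsymbol\pi^*-\boldsymbol\pi')\big)^2}{\sum_{a=1}^K \frac1{w_a}(\boldsymbol\pi^*-\boldsymbol\pi')_a^2}=\max_{\boldsymbol w\in\Pi}\ \min_{\boldsymbol\pi'\in\mathcal V_{\mathcal F}(\boldsymbol\pi^* )}\ \frac1{2\sigma^2}\,\frac{\|\boldsymbol\pi^*-\boldsymbol\pi'\|^2_{\boldsymbol\mu\boldsymbol\mu^\top}}{\|\boldsymbol\pi^*-\boldsymbol\pi'\|^2_{\mathrm{Diag}(1/w_a)}}.$$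 Here $\mathrm{Diag}(1/w_a)$ is the diagonal matrix whose $a$-th diagonal entry is $1/w_a$.
   Context: The vector of arm means $\boldsymbol\mu$ lies in the bounded domain $\mathcal D=[\mu_{\min},\mu_{\max}]^K$. $\Delta_{K-1}$ is the probability simplex in $\mathbb R^K$. The set of feasible policies is the non-empty compact polytope $\mathcal F=\{\boldsymbol\pi\in\Delta_{K-1}: B\boldsymbol\pi\le\boldsymbol c\}$ with $B,\boldsymbol c$ known, where the simplex constraints are also absorbed into $(B,\boldsymbol c)$. The set of feasible exploration policies is either $\Pi=\Delta_{K-1}$ or $\Pi=\mathcal F$, and $\boldsymbol w\in\Pi$. The optimal policy $\boldsymbol\pi^*=\arg\max_{\boldsymbol\pi\in\mathcal F}\boldsymbol\mu^\top\boldsymbol\pi$ is assumed to be unique (so it is an extreme point of $\mathcal F$). A policy $\boldsymbol\pi'$ is a neighbor of $\boldsymbol\pi^*$ if it is an extreme point of $\mathcal F$ (different from $\boldsymbol\pi^*$) and shares $K-1$ linearly independent active constraints with $\boldsymbol\pi^*$; $\mathcal V_{\mathcal F}(\boldsymbol\pi^* )$ is the set of all neighbors of $\boldsymbol\pi^*$. $d(x,y)$ is the KL divergence between arms with means $x$ and $y$; for Gaussian arms with common variance $\sigma^2$, $d(x,y)=(x-y)^2/(2\sigma^2)$. The set of alternative instances is $\Lambda_{\mathcal F}(\boldsymbol\mu)=\{\boldsymbol\lambda\in\mathcal D:\max_{\boldsymbol\pi\in\mathcal F}\boldsymbol\lambda^\top\boldsymbol\pi>\boldsymbol\lambda^\top\boldsymbol\pi^*\}$,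 and the characteristic time is defined by $T_{\mathcal F}(\boldsymbol\mu)^{-1}=\sup_{\boldsymbol w\in\Pi}\inf_{\boldsymbol\lambda\in\Lambda_{\mathcal F}(\boldsymbol\mu)}\sum_{a=1}^K w_a d(\mu_a,\lambda_a)$. For a vector $\boldsymbol v$ and a matrix $M$, $\|\boldsymbol v\|_M^2=\boldsymbol v^\top M\boldsymbol v$. In the maxima over $\boldsymbol w$, if $w_a=0$ the term $v_a^2/w_a$ is read as $0$ if $v_a=0$ and as $+\infty$ otherwise.
   Formalization: Adds that the closed-form projection lies in the bounded domain D: for the given w and neighbor in the first claim; for all w in Π and all neighbors with (π*−π')_a=0 wherever w_a=0 in the characteristic-time claim. Without this both claims can fail. *)

(* Defs.v *)
From HB Require Import structures.
From mathcomp Require Import all_boot all_order all_algebra.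
From mathcomp Require Import all_classical all_reals all_analysis.
Set Implicit Arguments.
Unset Strict Implicit.
Unset Printing Implicit Defensive.
Import Order.TTheory GRing.Theory Num.Theory.
Import numFieldNormedType.Exports.
Local Open Scope classical_set_scope.
Local Open Scope ring_scope.

(* MathComp world, over an abstract [R : realType].  Policies, allocations and
   vectors of means are column vectors ['cV[R]_K]. *)

Section Extrema.
Context {d : Order.disp_t} {T : porderType d} {I : Type}.
Implicit Types (S : set I) (f : I -> T).

Definition argmin_on S f (x : I) : Prop :=
  S x /\ forall y, S y -> (f x <= f y)%O.

Definition max_on S f (m : T) : Prop :=
  (exists2 x, S x & f x = m) /\ forall y, S y -> (f y <= m)%O.

Definition min_on S f (m : T) : Prop :=
  (exists2 x, S x & f x = m) /\ forall y, S y -> (m <= f y)%O.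

End Extrema.

(* [t = max_(x in S) min_(y in V) f x y], both extrema being attained.  The
   minimum over an empty [V] is +oo, the value of [ereal_inf set0]. *)
Definition maxmin_on {R : realType} {I J : Type} (S : set I) (V : set J)
    (f : I -> J -> \bar R) (t : \bar R) : Prop :=
  (forall x, S x -> V !=set0 -> min_on V (f x) (ereal_inf (f x @` V))) /\
  max_on S (fun x => ereal_inf (f x @` V)) t.

Section Polytope.
Context {R : realType} {K : nat}.
Implicit Types p q v : 'cV[R]_K.

Definition dot p q : R := (p^T *m q) 0 0.

Definition simplex : set 'cV[R]_K :=
  [set p | (forall a, 0 <= p a 0) /\ \sum_a p a 0 = 1].

Definition box (lo hi : R) : set 'cV[R]_K :=
  [set p | forall a, lo <= p a 0 <= hi].

Definition feasible m (B : 'M[R]_(m, K)) (c : 'cV[R]_m) : set 'cV[R]_K :=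
  [set p | simplex p /\ forall i, (B *m p) i 0 <= c i 0].

(* The system B p <= c with the simplex constraints absorbed: the extra rows
   are - p a <= 0 for every a, \sum_a p a <= 1 and - \sum_a p a <= - 1. *)
Definition full_lhs m (B : 'M[R]_(m, K)) : 'M[R]_(m + (K + (1 + 1)), K) :=
  col_mx B (col_mx (- 1%:M) (col_mx (const_mx 1) (const_mx (- 1)))).

Definition full_rhs m (c : 'cV[R]_m) : 'cV[R]_(m + (K + (1 + 1))) :=
  col_mx c (col_mx 0 (col_mx (const_mx 1) (const_mx (- 1)))).

Definition active n (A : 'M[R]_(n, K)) (b : 'cV[R]_n) p (i : 'I_n) : Prop :=
  (A *m p) i 0 = b i 0.

Definition extreme_point (C : set 'cV[R]_K) p : Prop :=
  C p /\ forall q1 q2 (t : R), C q1 -> C q2 -> 0 < t < 1 ->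
    p = t *: q1 + (1 - t) *: q2 -> q1 = p /\ q2 = p.

Definition share_active n (A : 'M[R]_(n, K)) (b : 'cV[R]_n) p q : Prop :=
  exists f : 'I_K.-1 -> 'I_n,
    row_free (rowsub f A) /\
    forall i, active A b p (f i) /\ active A b q (f i).

Definition neighbors m (B : 'M[R]_(m, K)) (c : 'cV[R]_m) p : set 'cV[R]_K :=
  [set q | [/\ extreme_point (feasible B c) q, q <> p &
               share_active (full_lhs B) (full_rhs c) p q]].

Definition unique_optimal (F : set 'cV[R]_K) (mu p : 'cV[R]_K) : Prop :=
  F p /\ forall q, F q -> q <> p -> dot mu q < dot mu p.

(* v^T M v.  Entries are extended reals, so that Diag(1/w) makes
   sense when w a = 0. *)
Definition normsq (M : 'M[\bar R]_K) v : \bar R :=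
  (\sum_a \sum_b (v a 0)%:E * M a b * (v b 0)%:E)%E.

(* In \bar R, 0^-1 = +oo and 0 * +oo = 0. *)
Definition diag_inv (w : 'cV[R]_K) : 'M[\bar R]_K :=
  \matrix_(a, b) (if a == b then ((w a 0)%:E)^-1 else 0)%E.

End Polytope.

Section Bandit.
Context {R : realType} {K : nat}.

Definition kl_pdf (p q : R -> R) : \bar R :=
  (\int[lebesgue_measure]_x (p x * ln (p x / q x))%:E)%E.

(* KL divergence between N(x, sigma^2) and N(y, sigma^2); the second argument
   of [normal_pdf] is the standard deviation. *)
Definition kl_gauss (sigma x y : R) : \bar R :=
  kl_pdf (normal_pdf x sigma) (normal_pdf y sigma).

Definition cost (d : R -> R -> \bar R) (w mu lam : 'cV[R]_K) : \bar R :=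
  (\sum_a (w a 0)%:E * d (mu a 0%R) (lam a 0%R))%E.

Definition alternatives (D F : set 'cV[R]_K) (pistar : 'cV[R]_K)
    : set 'cV[R]_K :=
  [set lam | D lam /\
    ((dot lam pistar)%:E < ereal_sup [set (dot lam p)%:E | p in F])%E].

(* Defined through its inverse; note that [inve] is an involution. *)
Definition char_time (d : R -> R -> \bar R) (D F Pi : set 'cV[R]_K)
    (mu pistar : 'cV[R]_K) : \bar R :=
  ((ereal_sup
     [set ereal_inf [set cost d w mu lam | lam in alternatives D F pistar]
     | w in Pi])^-1)%E.

(* The closed-form projection for the direction v = pistar - pi'.  Divisions
   are real ones, with x / 0 = 0; thus when every arm with w a = 0 satisfies
   v a = 0, those arms contribute 0 to the sum and are left unchanged. *)
Definition gauss_proj_coef (w mu v : 'cV[R]_K) : R :=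
  dot mu v / (\sum_b ((v b 0) ^+ 2 / w b 0)).

Definition gauss_proj (w mu v : 'cV[R]_K) : 'cV[R]_K :=
  \col_a (mu a 0 - gauss_proj_coef w mu v * (v a 0 / w a 0)).

(* The divisions by w a are those of \bar R: (v a)^2 / 0 is 0 if v a = 0 and
   +oo otherwise. *)
Definition ratio_sum (sigma : R) (mu w v : 'cV[R]_K) : \bar R :=
  (((2 * sigma ^+ 2)^-1)%:E *
   (((dot mu v) ^+ 2)%:E / (\sum_a (((v a 0) ^+ 2)%:E / (w a 0)%:E))))%E.

Definition ratio_norm (sigma : R) (mu w v : 'cV[R]_K) : \bar R :=
  (((2 * sigma ^+ 2)^-1)%:E *
   (normsq (map_mx EFin (mu *m mu^T)) v / normsq (diag_inv w) v))%E.

End Bandit.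

(* Main.v *)
(* Moving from pistar along an edge of the polytope until a new row blocks leads
   to a neighbor; hence, as in the simplex method, a point [lam] of the box is an
   alternative iff [dot lam (pistar - pi') < 0] for some neighbor pi'.  With
   quadratic Gaussian divergences, the infimum of the cost over such a half-space
   is given by the weighted Cauchy-Schwarz inequality, and passing to the open
   half-space does not change it.  If [w] has zeros on the support of
   [pistar - pi'], the infimum is 0: the projections for allocations tilted
   slightly from [w] towards the midpoint of pistar and pi' lie in the box, and
   their cost for [w] tends to 0.  The outer maximum exists because an infimum of
   linear functions of [w] is upper semicontinuous on the compact set Pi. *)
Require Import Defs.
From HB Require Import structures.
From mathcomp Require Import all_boot all_order all_algebra.
From mathcomp Require Import all_classical all_reals all_analysis.
From mathcomp Require Import measurable_realfun ring lra.
Set Implicit Arguments.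
Unset Strict Implicit.
Unset Printing Implicit Defensive.
Import Order.TTheory GRing.Theory Num.Theory.
Import numFieldNormedType.Exports.
Local Open Scope classical_set_scope.
Local Open Scope ring_scope.

(** * Divergence of Gaussian distributions *)

Section GaussianDivergence.
Context {R : realType}.
Implicit Types (m s x y t : R).
Local Notation leb := (@lebesgue_measure R).

Lemma normal_pdf_expR m s t : s != 0 ->
  normal_pdf m s t = normal_peak s * expR (- (t - m) ^+ 2 / (s ^+ 2 *+ 2)).
Proof. by move=> s0; rewrite normal_pdfE. Qed.

Lemma is_derive_normal_pdf m s t : s != 0 ->
  is_derive t 1 (normal_pdf m s) (- ((t - m) / s ^+ 2) * normal_pdf m s t).
Proof.
move=> s0; rewrite normal_pdfE// /normal_fun.
have -> : (fun x => normal_peak s * expR (- (x - m) ^+ 2 / (s ^+ 2 *+ 2)) : R)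
    = normal_peak s \*: (expR \o
        (fun x : R => - (s ^+ 2 *+ 2)^-1 * ((x - m) * (x - m)) : R)).
  by apply/funext => x /=; rewrite expr2; congr (_ * expR _); ring.
apply: is_derive_eq.
rewrite /GRing.scale /= expr2.
have -> : - (s ^+ 2 *+ 2)^-1 * ((t - m) * (t - m)) =
  - ((t - m) * (t - m)) / (s ^+ 2 *+ 2) by ring.
by field.
Qed.

Lemma cvg_normal_pdf m s : s != 0 -> normal_pdf m s t @[t --> +oo] --> (0 : R).
Proof.
move=> s0; rewrite normal_pdfE// /normal_fun -(mulr0 (normal_peak s)).
apply: cvgM; first exact: cvg_cst.
have -> : (fun x => expR (- (x - m) ^+ 2 / (s ^+ 2 *+ 2)) : R) =
   (fun x => expR (- x)) \o (fun x : R => (x - m) ^+ 2 * (s ^+ 2 *+ 2)^-1).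
  by apply/funext => x /=; rewrite mulNr.
apply: cvg_comp; last exact: cvgr_expR.
have s2 : 0 < (s ^+ 2 *+ 2)^-1.
  by rewrite invr_gt0 pmulrn_lgt0// exprn_even_gt0.
apply: gt0_cvgMly => //.
have -> : (fun x : R => (x - m) ^+ 2) = (fun x => x ^+ 2) \o (fun x => x - m) by [].
apply: cvg_comp; first exact: cvg_addrr.
exact: cvgr_expr2.
Qed.

(** The map [- s ^+ 2 * normal_pdf m s t] is an antiderivative of the integrand and vanishes at
    infinity. The integrand has constant sign on the half-line, so its improper integral is minus
    the value of the antiderivative at [m]. *)
Lemma integral_normal_half m s : s != 0 ->
  (\int[leb]_(t in `[m, +oo[) ((t - m) * normal_pdf m s t)%:E =
   (s ^+ 2 * normal_peak s)%:E)%E.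
Proof.
move=> s0; set F := fun t : R => (- s ^+ 2) * normal_pdf m s t.
have dF t : is_derive t 1 F ((t - m) * normal_pdf m s t).
  have -> : F = (- s ^+ 2) \*: normal_pdf m s by [].
  have dn := is_derive_normal_pdf m t s0.
  apply: is_derive_eq; rewrite /GRing.scale /=.
  by rewrite mulrA; congr (_ * _); field.
have cF : continuous F.
  by move=> t; apply: cvgM; [exact: cvg_cst|exact: continuous_normal_pdf].
rewrite (@ge0_continuous_FTC2y _ _ F m 0).
- rewrite /F normal_pdfE// /normal_fun subrr expr0n/= oppr0 mul0r expR0 mulr1.
  by rewrite -EFinB sub0r mulNr opprK.
- by move=> t mt; rewrite mulr_ge0 ?normal_pdf_ge0// subr_ge0.
- apply: continuous_subspaceT => t; apply: cvgM.
    by apply: cvgB; [exact: cvg_id|exact: cvg_cst].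
  exact: continuous_normal_pdf.
- by rewrite -(mulr0 (- s ^+ 2)); apply: cvgM;
    [exact: cvg_cst|exact: cvg_normal_pdf].
- by move=> t _; exact: (@ex_derive _ _ _ _ _ _ _ (dF t)).
- by apply: cvg_at_right_filter; exact: cF.
- by move=> t _; rewrite derive1E; exact: (@derive_val _ _ _ _ _ _ _ (dF t)).
Qed.

(** The substitution of [- t] for [t] exchanges the two half-lines and replaces the mean [m] by
    [- m]. *)
Lemma integral_normal_half_left m s : s != 0 ->
  (\int[leb]_(t in `]-oo, m]) ((m - t) * normal_pdf m s t)%:E =
   (s ^+ 2 * normal_peak s)%:E)%E.
Proof.
move=> s0; rewrite -(integral_normal_half (- m) s0) -[in LHS](opprK m).
rewrite ge0_integration_by_substitutionNy.
- apply: eq_integral => t _ /=; rewrite !normal_pdf_expR//.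
  by congr (_ * (_ * expR (_ / _)))%:E; ring.
- apply: continuous_subspaceT => t; apply: cvgM.
    by apply: cvgB; [exact: cvg_cst|exact: cvg_id].
  exact: continuous_normal_pdf.
- move=> t; rewrite in_itv/= opprK => /ltW tm.
  by rewrite mulr_ge0 ?normal_pdf_ge0// subr_ge0.
Qed.

Let mid m s : measurable_fun setT (EFin \o (fun t => (t - m) * normal_pdf m s t)).
Proof.
apply/measurable_EFinP; apply: measurable_funM; first exact: measurable_funB.
exact: measurable_normal_pdf.
Qed.

Lemma integral_split m (f : R -> \bar R) : measurable_fun setT f ->
  (\int[leb]_t f t = \int[leb]_(t in `]-oo, m]) f t
    + \int[leb]_(t in `[m, +oo[) f t)%E.
Proof.
move=> mf; have -> : [set: R] = `]-oo, m[%classic `|` `[m, +oo[%classic.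
  by rewrite -setCitvr setvU.
rewrite integral_setU//=.
(* The endpoint [m], shared by the two half-lines, is negligible. *)
- by rewrite integral_itv_bndo_bndc//; exact: measurable_funTS.
- exact: measurable_funTS.
- by rewrite -setCitvr; exact/disj_setPCr.
Qed.

Lemma integrable_normal_moment m s : s != 0 ->
  leb.-integrable setT (fun t => ((t - m) * normal_pdf m s t)%:E).
Proof.
move=> s0; apply/integrableP; split; first exact: mid.
rewrite (@integral_split m); last by apply: measurableT_comp => //; exact: mid.
have -> : (\int[leb]_(t in `]-oo, m]) `|((t - m) * normal_pdf m s t)%:E| =
    (s ^+ 2 * normal_peak s)%:E)%E.
  rewrite -(integral_normal_half_left m s0); apply: eq_integral => t.
  rewrite inE/= in_itv/= => tm; rewrite normrM distrC.
  by rewrite !ger0_norm ?normal_pdf_ge0 ?subr_ge0.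
have -> : (\int[leb]_(t in `[m, +oo[) `|((t - m) * normal_pdf m s t)%:E| =
    (s ^+ 2 * normal_peak s)%:E)%E.
  rewrite -(integral_normal_half m s0); apply: eq_integral => t.
  rewrite inE/= in_itv/= andbT => tm; rewrite normrM.
  by rewrite !ger0_norm ?normal_pdf_ge0 ?subr_ge0.
by rewrite -EFinD ltry.
Qed.

(** The two half-line integrals are opposite. *)
Lemma integral_normal_moment m s : s != 0 ->
  (\int[leb]_t ((t - m) * normal_pdf m s t)%:E = 0)%E.
Proof.
move=> s0; rewrite (@integral_split m); last exact: mid.
rewrite integral_normal_half//.
have -> : (\int[leb]_(t in `]-oo, m]) ((t - m) * normal_pdf m s t)%:E =
    - (s ^+ 2 * normal_peak s)%:E)%E.
  rewrite -(integral_normal_half_left m s0) -integral_ge0N; last first.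
    move=> t /=; rewrite in_itv/= => tm.
    by rewrite lee_fin mulr_ge0 ?normal_pdf_ge0 ?subr_ge0.
  by apply: eq_integral => t _; rewrite -EFinN -mulNr opprB.
by rewrite -EFinN -EFinD addNr.
Qed.

(** With equal variances the peaks cancel and so do the quadratic terms in [t]. The logarithm is
    affine in [t - x], so the divergence only involves the total mass and the centered first moment,
    which is 0. *)
Lemma normal_log_ratio s x y t : s != 0 ->
  ln (normal_pdf x s t / normal_pdf y s t) =
  (x - y) / s ^+ 2 * (t - x) + (x - y) ^+ 2 / (2 * s ^+ 2).
Proof.
move=> s0; rewrite !normal_pdf_expR//.
have p0 := normal_peak_gt0 s0.
rewrite invfM mulrACA divff ?gt_eqF// mul1r -expRN -expRD expRK.
by field.
Qed.

Lemma kl_gaussE s x y : s != 0 ->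
  kl_gauss s x y = ((x - y) ^+ 2 / (2 * s ^+ 2))%:E.
Proof.
move=> s0; rewrite /kl_gauss /kl_pdf.
under eq_integral => t _.
  rewrite normal_log_ratio// mulrDr mulrCA (mulrC (normal_pdf _ _ _) (t - x)).
  rewrite EFinD [in X in (X + _)%E]EFinM.
  rewrite (mulrC (normal_pdf _ _ _)) [in X in (_ + X)%E]EFinM.
  over.
have i1 := integrable_normal_moment x s0.
have i2 := integrable_normal_pdf x s.
rewrite integralD//; [|exact: integrableZl|exact: integrableZl].
rewrite integralZl// integralZl// integral_normal_moment// integral_normal_pdf.
by rewrite mule0 add0e mule1.
Qed.

End GaussianDivergence.

(** * Vertices and edges of polyhedra *)

Section LinearAlgebra.
Context {F : fieldType} {K : nat}.

Lemma rank_trivial_kernel r (M : 'M[F]_(r, K)) :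
  (forall e : 'cV_K, M *m e = 0 -> e = 0) -> \rank M = K.
Proof.
move=> kerM; rewrite -mxrank_tr; apply/eqP; change (row_free M^T).
rewrite -kermx_eq0; apply/rowV0P => u /sub_kermxP uM.
apply: (can_inj (@trmxK _ _ _)); rewrite trmx0; apply: kerM.
by apply: (can_inj (@trmxK _ _ _)); rewrite trmx_mul trmxK uM trmx0.
Qed.

Lemma rank_lt_of_kernel r (M : 'M[F]_(r, K)) (e : 'cV_K) :
  M *m e = 0 -> e != 0 -> (\rank M < K)%N.
Proof.
move=> Me; apply: contra_neqT; rewrite -leqNgt => rK.
have /row_fullP[N NM] : row_full M by rewrite /row_full eqn_leq rank_leq_col.
by rewrite -[e]mul1mx -NM -mulmxA Me mulmx0.
Qed.

Lemma free_rowsub_of_rank r (M : 'M[F]_(r, K)) k : k = \rank M ->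
  exists f : 'I_k -> 'I_r, row_free (rowsub f M).
Proof. by move=> ->; exists (maxrankfun M); exact: maxrowsub_free. Qed.

End LinearAlgebra.

Section Polyhedron.
Context {R : realType} {K : nat}.
Implicit Types (l d e p q x : 'cV[R]_K).

Lemma dotE p q : dot p q = \sum_a p a 0 * q a 0.
Proof. by rewrite /dot mxE; apply: eq_bigr => a _; rewrite mxE. Qed.

Lemma dotDr l p q : dot l (p + q) = dot l p + dot l q.
Proof. by rewrite /dot mulmxDr mxE. Qed.

Lemma dotNr l p : dot l (- p) = - dot l p.
Proof. by rewrite /dot mulmxN mxE. Qed.

Lemma dotBr l p q : dot l (p - q) = dot l p - dot l q.
Proof. by rewrite dotDr dotNr. Qed.

Lemma dotZr l (t : R) p : dot l (t *: p) = t * dot l p.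
Proof. by rewrite /dot -scalemxAr mxE. Qed.

Lemma dotC p q : dot p q = dot q p.
Proof. by rewrite !dotE; apply: eq_bigr => a _; rewrite mulrC. Qed.

Lemma rowDr n (A : 'M[R]_(n, K)) p q i :
  (A *m (p + q)) i 0 = (A *m p) i 0 + (A *m q) i 0.
Proof. by rewrite mulmxDr mxE. Qed.

Lemma rowNr n (A : 'M[R]_(n, K)) p i : (A *m (- p)) i 0 = - (A *m p) i 0.
Proof. by rewrite mulmxN mxE. Qed.

Lemma rowZr n (A : 'M[R]_(n, K)) (t : R) p i :
  (A *m (t *: p)) i 0 = t * (A *m p) i 0.
Proof. by rewrite -scalemxAr mxE. Qed.

(** The ratio test of the simplex method: with slacks [g] and rates [h], the longest admissible step
    is the least [g i / h i] over the rows with [0 < h i]. *)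
Lemma ratio_test (I : finType) (P : pred I) (g h : I -> R) :
  (forall i, P i -> 0 <= g i) -> (exists2 i, P i & 0 < h i) ->
  exists t, [/\ 0 <= t, forall i, P i -> t * h i <= g i &
    exists i, [/\ P i, 0 < h i & g i = t * h i]].
Proof.
move=> g0 [i1 Pi1 hi1].
have P1 : [pred i | P i && (0 < h i)] i1 by rewrite /= Pi1.
case: (arg_minP (fun i => g i / h i) P1) => i0 /andP[Pi0 hi0] min0.
have t0 : 0 <= g i0 / h i0 by rewrite divr_ge0 ?g0 ?ltW.
exists (g i0 / h i0); split => // [i Pi|].
  have [hi|hi] := ltP 0 (h i).
    by rewrite -ler_pdivlMr// min0//= Pi.
  by rewrite (le_trans _ (g0 i Pi))// mulr_ge0_le0.
by exists i0; split => //; rewrite divfK// gt_eqF.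
Qed.

Lemma small_step (I : finType) (P : pred I) (g h : I -> R) :
  (forall i, P i -> 0 < g i) ->
  exists2 t, 0 < t & forall i, P i -> t * h i <= g i.
Proof.
move=> g0; have [/existsP[i /andP[Pi hi]]|/existsPn nh] :=
    boolP [exists i, P i && (0 < h i)].
  have [||t [t0 tP [j [Pj hj gj]]]] := @ratio_test I P g h; last 1 first.
  - exists t => //; rewrite lt_neqAle t0 andbT eq_sym; apply/negP => /eqP t00.
    by have := g0 j Pj; rewrite gj t00 mul0r ltxx.
  - by move=> k /g0/ltW.
  - by exists i.
exists 1 => // i Pi; rewrite mul1r (le_trans _ (ltW (g0 i Pi)))//.
by have := nh i; rewrite Pi/= -leNgt.
Qed.

(* Among the directions of the cone that increase [l], one with as many tight
   rows as possible spans an edge: otherwise it can be moved along some [e],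
   keeping [l] and its tight rows, until another row becomes tight. *)
Lemma cone_edge n (A : 'M[R]_(n, K)) (I : pred 'I_n) l d :
  (forall e, (forall i, I i -> (A *m e) i 0 = 0) -> e = 0) ->
  (forall i, I i -> (A *m d) i 0 <= 0) -> 0 < dot l d ->
  exists d', [/\ forall i, I i -> (A *m d') i 0 <= 0, 0 < dot l d' &
    forall e, (forall i, I i -> (A *m d') i 0 = 0 -> (A *m e) i 0 = 0) ->
      dot l e = 0 -> e = 0].
Proof.
(* Induction on the number of rows of [I] that are strict at [d]. *)
move=> pointed; pose J d := [pred i | I i && ((A *m d) i 0 < 0)].
have [k] := ubnP #|J d|; elim: k d => // k IH d /ltnSE Jk dC ld.
have [Hd|] := pselect (forall e,
   (forall i, I i -> (A *m d) i 0 = 0 -> (A *m e) i 0 = 0) ->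
      dot l e = 0 -> e = 0); first by exists d.
move=> /existsNP[e1] /not_implyP[e1J] /not_implyP[le1] /eqP e10.
have [i1 [Ii1 i1e]] : exists i, I i /\ (A *m e1) i 0 != 0.
  apply: contrapT => H; move/eqP: e10; apply; apply: pointed => i Ii.
  by apply/eqP; apply: contrapT => /negP Hi; apply: H; exists i.
(* The sign of [e1] is chosen so that some row grows along [e] and eventually blocks. *)
have [e [eJ le [i2 Ii2 i2e]]] : exists e,
    [/\ forall i, I i -> (A *m d) i 0 = 0 -> (A *m e) i 0 = 0, dot l e = 0 &
        exists2 i, I i & 0 < (A *m e) i 0].
  have [pos|neg] := ltP 0 ((A *m e1) i1 0).
    by exists e1; split => //; exists i1.
  exists (- e1); split; first by move=> i Ii di; rewrite rowNr e1J ?oppr0.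
    by rewrite dotNr le1 oppr0.
  by exists i1 => //; rewrite rowNr oppr_gt0 lt_neqAle i1e.
have [||t [t0 tP [i0 [Ii0 i0e i0t]]]] :=
  @ratio_test _ I (fun i => - (A *m d) i 0) (fun i => (A *m e) i 0).
- by move=> i /dC; rewrite oppr_ge0.
- by exists i2.
apply: (IH (d + t *: e)).
(* Tight rows stay tight, and the blocking row [i0], strict at [d], becomes tight. *)
- rewrite (leq_trans _ Jk)//; apply/proper_card/properP; split.
    apply/fintype.subsetP => i; rewrite !inE rowDr rowZr => /andP[Ii Hi].
    rewrite Ii lt_neqAle dC// andbT; apply/eqP => di.
    by move: Hi; rewrite di (eJ _ Ii di) mulr0 addr0 ltxx.
  exists i0; rewrite !inE Ii0 /=.
    rewrite lt_neqAle dC// andbT; apply/eqP => di.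
    by move: i0e; rewrite eJ// ltxx.
  by rewrite rowDr rowZr -i0t subrr ltxx.
- by move=> i Ii; rewrite rowDr rowZr -lerBrDl sub0r tP.
- by rewrite dotDr dotZr le mulr0 addr0.
Qed.

(** The rows of [J] have rank less than [K], since they annihilate [d <> 0]. Adding the single row
    [l^T] brings the rank to [K], so it was exactly [K.-1]. *)
Lemma edge_free_rows n (A : 'M[R]_(n, K)) (J : pred 'I_n) l d :
  (forall i, J i -> (A *m d) i 0 = 0) -> 0 < dot l d ->
  (forall e, (forall i, J i -> (A *m e) i 0 = 0) -> dot l e = 0 -> e = 0) ->
  exists f : 'I_K.-1 -> 'I_n, row_free (rowsub f A) /\ forall i, J (f i).
Proof.
move=> dJ ld edge; pose AJ := rowsub (@enum_val _ J) A.
have AJE e i : (AJ *m e) i 0 = (A *m e) (enum_val i) 0.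
  by rewrite mul_rowsub_mx mxE.
have rankJl : \rank (col_mx AJ l^T) = K.
  apply: rank_trivial_kernel => e; rewrite mul_col_mx => /eqP.
  rewrite col_mx_eq0 => /andP[/eqP Je /eqP le]; apply: edge.
    by move=> i Ji; rewrite -(enum_rankK_in Ji Ji) -AJE Je mxE.
  by rewrite /dot le mxE.
have d0 : d != 0.
  by apply/eqP => d0; move: ld; rewrite d0 /dot mulmx0 mxE ltxx.
have rJ : (\rank AJ < K)%N.
  apply: (@rank_lt_of_kernel _ _ _ _ d) => //; apply/matrixP => i j.
  by rewrite ord1 AJE dJ ?mxE//; exact: enum_valP.
have rJ1 : K.-1 = \rank AJ.
  have : (K <= \rank AJ + 1)%N.
    rewrite -{1}rankJl -addsmxE (leq_trans (mxrank_adds_leqif _ _))//.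
    by rewrite leq_add2l rank_leq_row.
  by move: rJ; case: (K) (\rank AJ) => [|k] r //=; rewrite addn1 !ltnS => ? ?;
    apply/eqP; rewrite eqn_leq; apply/andP.
have [f ff] := free_rowsub_of_rank rJ1.
exists (fun i => enum_val (f i)); split; last by move=> i; exact: enum_valP.
suff -> : rowsub (fun i => enum_val (f i)) A = rowsub f AJ by [].
by apply/matrixP => i j; rewrite !mxE.
Qed.

Definition polyhedron n (A : 'M[R]_(n, K)) (b : 'cV[R]_n) : set 'cV[R]_K :=
  [set x | forall i, (A *m x) i 0 <= b i 0].

Lemma polyhedron_step n (A : 'M[R]_(n, K)) b p e : polyhedron A b p ->
  (forall i, active A b p i -> (A *m e) i 0 <= 0) ->
  exists2 t, 0 < t & polyhedron A b (p + t *: e).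
Proof.
move=> Pp pe.
have [|t t0 tP] := @small_step _ (fun i => (A *m p) i 0 != b i 0)
    (fun i => b i 0 - (A *m p) i 0) (fun i => (A *m e) i 0).
  by move=> i ip; rewrite subr_gt0 lt_neqAle ip Pp.
exists t => // i; rewrite rowDr rowZr -lerBrDl.
have [ip|/tP//] := eqVneq ((A *m p) i 0) (b i 0).
by rewrite ip subrr pmulr_rle0// pe.
Qed.

(** Along such an [e] one can take a positive step in both directions, and [p] lies strictly between
    the two end points. *)
Lemma extreme_pointed n (A : 'M[R]_(n, K)) b p e :
  extreme_point (polyhedron A b) p ->
  (forall i, active A b p i -> (A *m e) i 0 = 0) -> e = 0.
Proof.
move=> [Pp xp] pe.
have [||s s0 Ps] := @polyhedron_step _ A b p e => //.
  by move=> i /pe ->.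
have [||t t0 Pt] := @polyhedron_step _ A b p (- e) => //.
  by move=> i /pe ei; rewrite rowNr ei oppr0.
have st0 : 0 < s + t by rewrite addr_gt0.
(* With this weight the displacements [s *: e] and [- t *: e] cancel. *)
have [||] := xp _ _ (t / (s + t)) Ps Pt.
- by rewrite divr_gt0//= ltr_pdivrMr// mul1r ltrDr.
- by apply/matrixP => i j; rewrite !mxE; field; rewrite gt_eqF.
move=> + _; rewrite -[X in _ = X]addr0 => /addrI/eqP.
by rewrite scaler_eq0 gt_eqF//= => /eqP.
Qed.

(** A row active at a proper convex combination is active at both of its points, so each of them
    differs from [q] by a vector of the trivial kernel. *)
Lemma pointed_extreme n (A : 'M[R]_(n, K)) b q : polyhedron A b q ->
  (forall e, (forall i, active A b q i -> (A *m e) i 0 = 0) -> e = 0) ->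
  extreme_point (polyhedron A b) q.
Proof.
move=> Pq ker; split => // q1 q2 t P1 P2 /andP[t0 t1] qE.
have tight i : active A b q i ->
    (A *m q1) i 0 = b i 0 /\ (A *m q2) i 0 = b i 0.
  move=> iq; have := P1 i; have := P2 i; move: iq; rewrite /active qE.
  rewrite rowDr !rowZr; set y1 := (A *m q1) i 0; set y2 := (A *m q2) i 0.
  move=> bE y2b y1b; split; apply/eqP; rewrite eq_le ?y1b ?y2b/= leNgt;
    apply/negP => yb.
    have : t * y1 < t * b i 0 by rewrite ltr_pM2l.
    have : (1 - t) * y2 <= (1 - t) * b i 0 by rewrite ler_pM2l// subr_gt0.
    lra.
  have : t * y1 <= t * b i 0 by rewrite ler_pM2l.
  have : (1 - t) * y2 < (1 - t) * b i 0 by rewrite ltr_pM2l// subr_gt0.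
  lra.
by split; apply/eqP; rewrite -subr_eq0; apply/eqP; apply: ker => i iq;
  rewrite rowDr rowNr iq; have [b1 b2] := tight i iq; rewrite ?b1 ?b2 subrr.
Qed.

(** One simplex pivot. The direction [x - p] is replaced by an edge direction [d] of the cone of
    active rows at [p], which is followed until a row [i0] blocks. The first hypothesis, a trivial
    recession cone, guarantees that one does. *)
Lemma improving_neighbor n (A : 'M[R]_(n, K)) b l p x :
  (forall d, d != 0 -> exists i, 0 < (A *m d) i 0) ->
  extreme_point (polyhedron A b) p -> polyhedron A b x ->
  dot l p < dot l x ->
  exists q, [/\ extreme_point (polyhedron A b) q, q <> p,
    share_active A b p q & dot l p < dot l q].
Proof.
move=> bounded xp Px lpx; have Pp := xp.1.
pose I := [pred i | (A *m p) i 0 == b i 0].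
have [|||d [dC ld edge]] := @cone_edge _ A I l (x - p).
- by move=> e eI; apply: (extreme_pointed xp) => i /eqP /eI.
- by move=> i /eqP ip; rewrite rowDr rowNr ip subr_le0 Px.
- by rewrite dotBr subr_gt0.
pose J := [pred i | I i && ((A *m d) i 0 == 0)].
have edgeJ e : (forall i, J i -> (A *m e) i 0 = 0) -> dot l e = 0 -> e = 0.
  move=> eJ; apply: edge => i Ii di; apply: eJ.
  by rewrite /J inE Ii di/=.
have [|f [ff fJ]] := @edge_free_rows _ A J l d _ ld edgeJ.
  by move=> i /andP[_ /eqP].
have d0 : d != 0.
  by apply/eqP => d0; move: ld; rewrite d0 /dot mulmx0 mxE ltxx.
have [i1 i1d] := bounded d d0.
have [||t [t0 tP [i0 [_ i0d i0t]]]] := @ratio_test _ predT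
   (fun i => b i 0 - (A *m p) i 0) (fun i => (A *m d) i 0).
- by move=> i _; rewrite subr_ge0 Pp.
- by exists i1.
(* A null step would make [i0] active at [p], and active rows do not grow along [d]. *)
have {}t0 : 0 < t.
  rewrite lt_neqAle t0 andbT eq_sym; apply/eqP => tz.
  move: i0t => /eqP; rewrite tz mul0r subr_eq0 eq_sym => /dC.
  by rewrite leNgt i0d.
have Jq i : J i -> active A b (p + t *: d) i.
  by move=> /andP[/eqP ip /eqP id]; rewrite /active rowDr rowZr id mulr0 addr0.
have i0q : active A b (p + t *: d) i0 by rewrite /active rowDr rowZr -i0t subrKC.
exists (p + t *: d); split.
- apply: pointed_extreme.
    by move=> i; rewrite rowDr rowZr -lerBrDl tP.
  (* The rows of [J] and [l] vanish on [e - s *: d], hence [e = s *: d]; then row [i0], active at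
     the new point and positive on [d], forces [s = 0]. *)
  move=> e eq; pose s := dot l e / dot l d.
  have es : e = s *: d.
    apply/eqP; rewrite -subr_eq0; apply/eqP; apply: edgeJ.
      move=> i Ji; rewrite rowDr rowNr rowZr eq; last exact: Jq.
      by move: Ji => /andP[_ /eqP ->]; rewrite mulr0 subrr.
    by rewrite dotBr dotZr /s divfK ?subrr// gt_eqF.
  have /eqP := eq _ i0q; rewrite es rowZr mulf_eq0 (gt_eqF i0d) orbF => /eqP ->.
  by rewrite scale0r.
- rewrite -[X in _ = X]addr0 => /addrI/eqP.
  by rewrite scaler_eq0 (negbTE d0) orbF gt_eqF.
- exists f; split => // i; split; last exact: Jq.
  by have /andP[/eqP] := fJ i.
- by rewrite dotDr dotZr ltrDl mulr_gt0.
Qed.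

Lemma extreme_eq n (A : 'M[R]_(n, K)) b q q' :
  extreme_point (polyhedron A b) q ->
  (forall i, active A b q i -> active A b q' i) -> q' = q.
Proof.
move=> xq qq'; apply/eqP; rewrite -subr_eq0; apply/eqP.
apply: (extreme_pointed xq) => i iq.
by rewrite rowDr rowNr iq (qq' _ iq) subrr.
Qed.

(* An extreme point is determined by its set of active rows, so there are
   finitely many of them. *)
Lemma min_on_extreme n (A : 'M[R]_(n, K)) b (V : set 'cV[R]_K)
    (f : 'cV[R]_K -> \bar R) :
  V `<=` extreme_point (polyhedron A b) -> V !=set0 ->
  min_on V f (ereal_inf (f @` V)).
Proof.
move=> Vx [q1 Vq1].
pose act q : {set 'I_n} := [set i | (A *m q) i 0 == b i 0]%SET.
have actE q i : (i \in act q) <-> active A b q i.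
  by rewrite inE; split => /eqP.
pose V_ S := [set q | V q /\ act q = S].
pose F S := f (xget 0 (V_ S)).
have V_q q : V q -> xget 0 (V_ (act q)) = q.
  move=> Vq; case: xgetP => [q' _ [Vq' qq']|/(_ q)[]//].
  by apply: (extreme_eq (Vx _ Vq)) => i /actE; rewrite -qq' => /actE.
(* The minimum is taken over the finite type of row sets, restricted to those realized in [V] so
   that the default value of [xget] cannot interfere. *)
have P1 : [pred S | act (xget 0 (V_ S)) == S & `[< V (xget 0 (V_ S)) >]] (act q1).
  by rewrite /= V_q// eqxx; apply/asboolP.
case: (arg_minP F P1) => S0 /andP[_ /asboolP VS0] minF.
have le q : V q -> (F S0 <= f q)%E.
  move=> Vq; rewrite -(V_q q Vq); apply: minF.
  by rewrite /= V_q// eqxx; apply/asboolP.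
have -> : ereal_inf (f @` V) = F S0.
  apply/eqP; rewrite eq_le; apply/andP; split.
    by apply: ereal_inf_lbound; exists (xget 0 (V_ S0)).
  by apply/ereal_infP => _ [q Vq <-]; exact: le.
by split => //; exists (xget 0 (V_ S0)).
Qed.

Lemma full_lhs_mul m (B : 'M[R]_(m, K)) x :
  full_lhs B *m x = col_mx (B *m x) (col_mx (- x)
    (col_mx (\sum_a x a 0)%:M (- \sum_a x a 0)%:M)).
Proof.
rewrite /full_lhs !mul_col_mx mulNmx mul1mx; congr (col_mx _ (col_mx _ _)).
by congr col_mx; apply/matrixP => i j; rewrite !ord1 !mxE -?sumrN;
  apply: eq_bigr => a _; rewrite mxE ?mul1r ?mulN1r.
Qed.

Lemma feasible_polyhedron m (B : 'M[R]_(m, K)) c :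
  feasible B c = polyhedron (full_lhs B) (full_rhs c).
Proof.
apply/seteqP; split => x; rewrite /polyhedron /= full_lhs_mul /full_rhs.
  move=> [[x0 x1] xB] i.
  case: (split_ordP i) => j ->; rewrite ?col_mxEu ?col_mxEd//.
  case: (split_ordP j) => k ->; rewrite ?col_mxEu ?col_mxEd.
    by rewrite !mxE oppr_le0.
  by case: (split_ordP k) => o ->; rewrite ?col_mxEu ?col_mxEd ord1 x1 !mxE.
move=> H; split; first split.
- move=> a; have := H (rshift _ (lshift _ a)).
  by rewrite !(col_mxEu, col_mxEd) !mxE oppr_le0.
- have := H (rshift _ (rshift _ (lshift _ ord0))).
  have := H (rshift _ (rshift _ (rshift _ ord0))).
  rewrite !(col_mxEu, col_mxEd) !mxE /= !mulr1n lerN2 => h1 h2.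
  by apply/eqP; rewrite eq_le h1 h2.
- by move=> i; have := H (lshift _ i); rewrite !col_mxEu.
Qed.

(** Otherwise the absorbed simplex rows make [d] a non-negative vector with sum at most 0, hence
    null. *)
Lemma full_lhs_bounded m (B : 'M[R]_(m, K)) d : d != 0 ->
  exists i, 0 < (full_lhs B *m d) i 0.
Proof.
move=> d0; apply: contrapT => H.
have {}H i : (full_lhs B *m d) i 0 <= 0.
  by rewrite leNgt; apply/negP => Hi; apply: H; exists i.
have d_ge0 a : 0 <= d a 0.
  have := H (rshift _ (lshift _ a)); rewrite full_lhs_mul.
  by rewrite !(col_mxEu, col_mxEd) !mxE oppr_le0.
have : \sum_a d a 0 <= 0.
  have := H (rshift _ (rshift _ (lshift _ ord0))); rewrite full_lhs_mul.
  by rewrite !(col_mxEu, col_mxEd) !mxE mulr1n.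
rewrite le_eqVlt ltNge sumr_ge0// orbF psumr_eq0// => /allP dz.
move/eqP: d0; apply; apply/matrixP => a j; rewrite ord1 mxE.
by apply/eqP; apply: dz; rewrite mem_index_enum.
Qed.

Lemma unique_optimal_extreme (F : set 'cV[R]_K) mu p :
  unique_optimal F mu p -> extreme_point F p.
Proof.
move=> [Fp opt]; split => // q1 q2 t F1 F2 /andP[t0 t1] pE.
have le q : F q -> dot mu q <= dot mu p.
  by move=> Fq; have [->//|/eqP/(opt _ Fq)/ltW] := eqVneq q p.
have muE : dot mu p = t * dot mu q1 + (1 - t) * dot mu q2.
  by rewrite {1}pE dotDr !dotZr.
split; apply: contrapT => /opt.
  move=> /(_ F1); rewrite -(ltr_pM2l t0) => h1.
  have : (1 - t) * dot mu q2 <= (1 - t) * dot mu p.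
    by rewrite ler_pM2l ?le// subr_gt0.
  by move: h1 muE; lra.
move=> /(_ F2); rewrite -(@ltr_pM2l _ (1 - t)) ?subr_gt0// => h1.
have : t * dot mu q1 <= t * dot mu p by rewrite ler_pM2l ?le.
by move: h1 muE; lra.
Qed.

Lemma neighbor_improving m (B : 'M[R]_(m, K)) c mu l p x :
  unique_optimal (feasible B c) mu p -> feasible B c x ->
  dot l p < dot l x -> exists2 q, neighbors B c p q & dot l p < dot l q.
Proof.
move=> /unique_optimal_extreme; rewrite /neighbors feasible_polyhedron.
move=> xp Fx lx; have [q [? ? ? ?]] :=
  improving_neighbor (@full_lhs_bounded _ B) xp Fx lx.
by exists q.
Qed.

End Polyhedron.

(** * Projection on a half-space *)

Section Projection.
Context {R : realType} {K : nat}.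
Implicit Types (w mu lam v u : 'cV[R]_K) (sigma : R).

Definition sqdist w mu lam : R := \sum_a w a 0 * (mu a 0 - lam a 0) ^+ 2.

Definition inv_weight w v : R := \sum_a v a 0 ^+ 2 / w a 0.

(** Under this condition the real quotients of [inv_weight], where [x / 0 = 0], agree with the
    extended ones of [ratio_sum]. *)
Definition supported w v := forall a, w a 0 = 0 -> v a 0 = 0.

Lemma sqdist_ge0 w mu lam : (forall a, 0 <= w a 0) -> 0 <= sqdist w mu lam.
Proof. by move=> w0; apply: sumr_ge0 => a _; rewrite mulr_ge0 ?sqr_ge0. Qed.

Lemma cost_gaussE sigma w mu lam : sigma != 0 ->
  cost (kl_gauss sigma) w mu lam =
  (sqdist w mu lam / (2 * sigma ^+ 2))%:E.
Proof.
move=> s0; rewrite /cost /sqdist mulr_suml -sumEFin; apply: eq_bigr => a _.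
by rewrite kl_gaussE// -EFinM mulrA.
Qed.

Lemma inv_weight_gt0 w v : (forall a, 0 <= w a 0) -> supported w v -> v != 0 ->
  0 < inv_weight w v.
Proof.
move=> w0 wv /eqP v0.
have [a va] : exists a, v a 0 != 0.
  apply: contrapT => H; apply: v0; apply/matrixP => a j; rewrite ord1 mxE.
  by apply/eqP; apply: contrapT => /negP va; apply: H; exists a.
have wa : 0 < w a 0.
  by rewrite lt_neqAle w0 eq_sym andbT; apply: contra va => /eqP/wv ->.
rewrite /inv_weight (bigD1 a)//= ltr_pwDl ?divr_gt0 ?exprn_even_gt0//.
by apply: sumr_ge0 => b _; rewrite divr_ge0 ?sqr_ge0.
Qed.

Lemma inve_term (x y : R) : (y = 0 -> x = 0) ->
  ((x ^+ 2)%:E / y%:E = (x ^+ 2 / y)%:E)%E.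
Proof.
move=> yx; rewrite inver; case: eqP => [y0|_]; last by rewrite EFinM.
by rewrite yx// expr0n/= mul0e mul0r.
Qed.

Lemma ratio_sum_supported sigma mu w v :
  (forall a, 0 <= w a 0) -> supported w v -> v != 0 ->
  ratio_sum sigma mu w v =
  (dot mu v ^+ 2 / inv_weight w v / (2 * sigma ^+ 2))%:E.
Proof.
move=> w0 wv v0; rewrite /ratio_sum.
under eq_bigr => a _ do rewrite (inve_term (wv a)).
have S0 := inv_weight_gt0 w0 wv v0.
rewrite sumEFin -/(inv_weight w v) inver gt_eqF// -!EFinM.
by congr _%:E; rewrite mulrC.
Qed.

(** The term of arm [a] is +oo and the others are non-negative, so the denominator is +oo and its
    inverse 0. *)
Lemma ratio_sum_unsupported sigma mu w v a : (forall a, 0 <= w a 0) ->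
  w a 0 = 0 -> v a 0 != 0 -> ratio_sum sigma mu w v = 0%E.
Proof.
move=> w0 wa va; rewrite /ratio_sum.
suff -> : (\sum_a ((v a 0 ^+ 2)%:E / (w a 0)%:E))%E = +oo%E.
  by rewrite invey !mule0.
rewrite (bigD1 a)//= wa inve0 gt0_muley ?lte_fin ?exprn_even_gt0// addye//.
rewrite gt_eqF// (lt_le_trans (ltNyr 0))//; apply: sume_ge0 => b _.
by rewrite mule_ge0 ?inve_ge0 ?lee_fin ?sqr_ge0.
Qed.

Lemma ratio_norm_sum sigma mu w v :
  ratio_norm sigma mu w v = ratio_sum sigma mu w v.
Proof.
rewrite /ratio_norm /ratio_sum; congr (_ * (_ / _))%E.
  rewrite /normsq (expr2 (dot mu v)) dotE mulr_suml -sumEFin.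
  apply: eq_bigr => a _; rewrite mulr_sumr -sumEFin; apply: eq_bigr => b _.
  rewrite !mxE big_ord1 !mxE -!EFinM; congr _%:E; ring.
rewrite /normsq; apply: eq_bigr => a _; rewrite (bigD1 a)//= big1 ?adde0.
  rewrite mxE eqxx muleAC -EFinM -expr2//.
by move=> b ba; rewrite mxE eq_sym (negbTE ba) mule0 mul0e.
Qed.

(* Expand [0 <= \sum_a w_a * (mu_a - lam_a - gamma * v_a / w_a) ^+ 2]. *)
Lemma sqdist_halfspace w mu v lam : (forall a, 0 <= w a 0) -> supported w v ->
  v != 0 -> 0 <= dot mu v -> dot lam v <= 0 ->
  dot mu v ^+ 2 / inv_weight w v <= sqdist w mu lam.
Proof.
move=> w0 wv v0 mv lv; have S0 := inv_weight_gt0 w0 wv v0.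
set g := dot mu v / inv_weight w v.
have g0 : 0 <= g by rewrite divr_ge0// ltW.
have : 0 <= \sum_a w a 0 * (mu a 0 - lam a 0 - g * (v a 0 / w a 0)) ^+ 2.
  by apply: sumr_ge0 => a _; rewrite mulr_ge0 ?sqr_ge0.
have -> : \sum_a w a 0 * (mu a 0 - lam a 0 - g * (v a 0 / w a 0)) ^+ 2 =
    sqdist w mu lam - 2 * g * (dot mu v - dot lam v) + g ^+ 2 * inv_weight w v.
  rewrite !dotE /sqdist /inv_weight -sumrB !mulr_sumr -sumrB -big_split/=.
  apply: eq_bigr => a _; have [wa|wa] := eqVneq (w a 0) 0; last by field.
  by rewrite wa wv// invr0; ring.
have -> : g ^+ 2 * inv_weight w v = g * dot mu v.
  by rewrite expr2 -mulrA divfK// gt_eqF.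
have -> : dot mu v ^+ 2 / inv_weight w v = g * dot mu v.
  by rewrite expr2 mulrAC.
have : g * dot lam v <= 0 by rewrite mulr_ge0_le0.
lra.
Qed.

Lemma dot_gauss_proj w mu v : inv_weight w v != 0 ->
  dot (gauss_proj w mu v) v = 0.
Proof.
move=> S0; rewrite dotE.
have -> : \sum_a gauss_proj w mu v a 0 * v a 0 =
    dot mu v - gauss_proj_coef w mu v * inv_weight w v.
  rewrite dotE /inv_weight mulr_sumr -sumrB; apply: eq_bigr => a _.
  by rewrite mxE; ring.
by rewrite /gauss_proj_coef -/(inv_weight w v) divfK// subrr.
Qed.

Lemma sqdist_gauss_proj w mu v : inv_weight w v != 0 ->
  sqdist w mu (gauss_proj w mu v) = dot mu v ^+ 2 / inv_weight w v.
Proof.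
move=> S0.
have -> : sqdist w mu (gauss_proj w mu v) =
    gauss_proj_coef w mu v ^+ 2 * inv_weight w v.
  rewrite /sqdist /inv_weight mulr_sumr; apply: eq_bigr => a _; rewrite mxE.
  have [wa|wa] := eqVneq (w a 0) 0; last by field.
  by rewrite wa invr0 !mulr0 mul0r.
by rewrite /gauss_proj_coef -/(inv_weight w v); field.
Qed.

Lemma ratio_sum_le_cost sigma w mu v lam : sigma != 0 ->
  (forall a, 0 <= w a 0) -> v != 0 -> 0 <= dot mu v -> dot lam v <= 0 ->
  (ratio_sum sigma mu w v <= cost (kl_gauss sigma) w mu lam)%E.
Proof.
move=> s0 w0 v0 mv lv; rewrite cost_gaussE//.
have s2 : 0 <= (2 * sigma ^+ 2)^-1 by rewrite invr_ge0 mulr_ge0 ?sqr_ge0.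
have [wv|] := pselect (supported w v).
  by rewrite ratio_sum_supported// lee_fin ler_wpM2r ?sqdist_halfspace.
move=> /existsNP[a /not_implyP[wa /eqP va]].
by rewrite (ratio_sum_unsupported _ _ w0 wa va) lee_fin mulr_ge0 ?sqdist_ge0.
Qed.

Lemma box_convex lo hi p q (t : R) : 0 <= t <= 1 -> box lo hi p ->
  box lo hi q -> box lo hi ((1 - t) *: p + t *: q : 'cV[R]_K).
Proof.
move=> /andP[t0 t1] bp bq a; rewrite !mxE.
have /andP[p1 p2] := bp a; have /andP[q1 q2] := bq a.
have t1' : 0 <= 1 - t by rewrite subr_ge0.
have := ler_wpM2l t1' p1; have := ler_wpM2l t1' p2.
have := ler_wpM2l t0 q1; have := ler_wpM2l t0 q2.
by move=> ? ? ? ?; apply/andP; split; lra.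
Qed.

(* The reflection of [mu] through the center of the box provides a point of the
   open half-space, towards which [lam] can be moved. *)
Lemma open_halfspace_approx lo hi w mu v lam (e : R) :
  (forall a, 0 <= w a 0) -> \sum_a v a 0 = 0 -> 0 < dot mu v ->
  box lo hi mu -> box lo hi lam -> dot lam v <= 0 -> 0 < e ->
  exists lam', [/\ box lo hi lam', dot lam' v < 0 &
    sqdist w mu lam' <= sqdist w mu lam + e].
Proof.
move=> w0 v1 mv bmu blam lv e0.
pose nu : 'cV[R]_K := \col_a (lo + hi - mu a 0).
have bnu : box lo hi nu.
  by move=> a; rewrite mxE; have /andP[? ?] := bmu a; apply/andP; split; lra.
have nuv : dot nu v < 0.
  have -> : dot nu v = (lo + hi) * (\sum_a v a 0) - dot mu v.
    rewrite !dotE mulr_sumr -sumrB; apply: eq_bigr => a _.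
    by rewrite mxE; ring.
  by rewrite v1 mulr0 sub0r oppr_lt0.
pose D := sqdist w mu nu; have D0 : 0 <= D by exact: sqdist_ge0.
have eD : 0 < e + D + 1 by rewrite addr_gt0// ltr_wpDr.
(* This weight on [nu] is less than 1 and satisfies [t * D <= e]. *)
pose t := e / (e + D + 1).
have t0 : 0 < t by rewrite divr_gt0.
have t1 : t < 1 by rewrite ltr_pdivrMr// mul1r; lra.
have tD : t * D <= e.
  rewrite /t mulrAC ler_pdivrMr// ler_wpM2l ?(ltW e0)//; lra.
clearbody t; exists ((1 - t) *: lam + t *: nu); split.
- by apply: box_convex => //; rewrite !ltW.
- rewrite dotC dotDr !dotZr !(dotC v).
  have : (1 - t) * dot lam v <= 0 by rewrite mulr_ge0_le0// subr_ge0 ltW.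
  have : t * dot nu v < 0 by rewrite pmulr_rlt0.
  lra.
(* Convexity of the square, with explicit gap [t * (1 - t) * (x - y) ^+ 2]. *)
- apply: (@le_trans _ _ ((1 - t) * sqdist w mu lam + t * D)).
    rewrite /D /sqdist !mulr_sumr -big_split/=; apply: ler_sum => a _.
    rewrite !mxE -subr_ge0.
    set x := mu a 0 - lam a 0; set y := mu a 0 - (lo + hi - mu a 0).
    have -> : (1 - t) * (w a 0 * x ^+ 2) + t * (w a 0 * y ^+ 2) -
       w a 0 * (mu a 0 - ((1 - t) * lam a 0 + t * (lo + hi - mu a 0))) ^+ 2 =
       w a 0 * (t * (1 - t) * (x - y) ^+ 2) by rewrite /x /y; ring.
    apply: mulr_ge0 => //; rewrite mulr_ge0 ?sqr_ge0//.
    by rewrite mulr_ge0 ?subr_ge0 ?ltW.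
  have : 0 <= t * sqdist w mu lam by rewrite mulr_ge0 ?sqdist_ge0 ?ltW.
  lra.
Qed.

(* If some [a] has [w a = 0] and [v a <> 0], tilting [w] slightly towards [u]
   makes the projection move essentially only arms of weight zero. *)
Lemma vanishing_gauss_proj w u mu v a (e : R) :
  (forall b, 0 <= w b 0) -> (forall b, 0 <= u b 0) ->
  (forall b, v b 0 != 0 -> 0 < u b 0) -> w a 0 = 0 -> v a 0 != 0 -> 0 < e ->
  exists t, let w' := (1 - t) *: w + t *: u in
    [/\ 0 < t < 1, supported w' v & sqdist w mu (gauss_proj w' mu v) <= e].
Proof.
move=> w0 u0 uv wa va e0; have ua := uv a va.
(* Arm [a] alone gives [inv_weight w' v >= v a 0 ^+ 2 / (t * u a 0)], so the cost for [w'] is at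
   most [t * M / 2]. The choice of [t] below ensures [t <= 1 / 2] and [t * M <= e]. *)
pose M := 2 * dot mu v ^+ 2 * u a 0 / v a 0 ^+ 2.
have va2 : 0 < v a 0 ^+ 2 by rewrite exprn_even_gt0.
have M0 : 0 <= M by rewrite divr_ge0 ?sqr_ge0// mulr_ge0// mulr_ge0// sqr_ge0.
pose t := e / (2 * (e + M)).
have eM : 0 < 2 * (e + M) by rewrite mulr_gt0// ltr_wpDr.
have t0 : 0 < t by rewrite divr_gt0.
have t12 : t <= 1 / 2.
  rewrite /t ler_pdivrMr//; lra.
have tM : t * M <= e.
  rewrite /t mulrAC ler_pdivrMr// ler_wpM2l ?(ltW e0)//; lra.
have t1 : 0 < 1 - t by lra.
clearbody t; exists t => /=; set w' := _ + _.
have w'E b : w' b 0 = (1 - t) * w b 0 + t * u b 0 by rewrite !mxE.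
have ww' b : (1 - t) * w b 0 <= w' b 0.
  by rewrite w'E lerDl mulr_ge0// ltW.
have w'0 b : 0 <= w' b 0 by rewrite (le_trans _ (ww' b))// mulr_ge0// ltW.
have w'v : supported w' v.
  move=> b; rewrite w'E => w'b; apply/eqP; apply/negPn/negP => vb.
  have : 0 < t * u b 0 by rewrite mulr_gt0// uv.
  have : 0 <= (1 - t) * w b 0 by rewrite mulr_ge0// ltW.
  by move: w'b; lra.
have v0 : v != 0 by apply: contraNneq va => ->; rewrite mxE.
have S0 := inv_weight_gt0 w'0 w'v v0.
split => //; first by rewrite t0; lra.
(* Since [w'] dominates [(1 - t) *: w], the cost for [w] is controlled by that for [w']. *)
have wle : (1 - t) * sqdist w mu (gauss_proj w' mu v) <=
    dot mu v ^+ 2 / inv_weight w' v.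
  rewrite -sqdist_gauss_proj ?gt_eqF// /sqdist mulr_sumr; apply: ler_sum => b _.
  by rewrite mulrA ler_wpM2r ?sqr_ge0.
have Sle : v a 0 ^+ 2 / (t * u a 0) <= inv_weight w' v.
  rewrite /inv_weight (bigD1 a)//= w'E wa mulr0 add0r lerDl.
  by apply: sumr_ge0 => b _; rewrite divr_ge0 ?sqr_ge0.
have Mle : dot mu v ^+ 2 / inv_weight w' v <= t * M / 2.
  have -> : t * M / 2 = dot mu v ^+ 2 * (v a 0 ^+ 2 / (t * u a 0))^-1.
    by rewrite /M; field; rewrite va !gt_eqF.
  rewrite ler_wpM2l ?sqr_ge0// lef_pV2// posrE divr_gt0// mulr_gt0//.
have : 1 / 2 * sqdist w mu (gauss_proj w' mu v) <=
   (1 - t) * sqdist w mu (gauss_proj w' mu v).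
  by rewrite ler_wpM2r ?sqdist_ge0//; lra.
lra.
Qed.

(** If [w] supports [v], the projection for [w] itself (the case [t = 0] of the box hypothesis) is
    pushed into the open half-space. Otherwise the ratio is 0, and the projection for a tilted
    allocation is pushed instead. *)
Lemma ratio_sum_approx sigma lo hi w u mu v (e : R) :
  sigma != 0 -> (forall a, 0 <= w a 0) -> (forall a, 0 <= u a 0) ->
  (forall a, v a 0 != 0 -> 0 < u a 0) ->
  (forall t, let w' := (1 - t) *: w + t *: u in
     0 <= t < 1 -> supported w' v -> box lo hi (gauss_proj w' mu v)) ->
  box lo hi mu -> \sum_a v a 0 = 0 -> 0 < dot mu v -> 0 < e ->
  exists lam, [/\ box lo hi lam, dot lam v < 0 &
    (cost (kl_gauss sigma) w mu lam <= ratio_sum sigma mu w v + e%:E)%E].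
Proof.
move=> s0 w0 u0 uv bproj bmu v1 mv e0.
have v0 : v != 0.
  by apply: contraTneq mv => ->; rewrite /dot mulmx0 mxE ltxx.
have s2 : 0 < 2 * sigma ^+ 2 by rewrite mulr_gt0// exprn_even_gt0.
have [wv|] := pselect (supported w v).
  have S0 := inv_weight_gt0 w0 wv v0.
  have b0 : box lo hi (gauss_proj w mu v).
    have := bproj 0; rewrite /= subr0 scale1r scale0r addr0 lexx ltr01.
    exact.
  have [|lam [blam lv le]] := @open_halfspace_approx lo hi w mu v _
      (e * (2 * sigma ^+ 2)) w0 v1 mv bmu b0 _ (mulr_gt0 e0 s2).
    by rewrite dot_gauss_proj// gt_eqF.
  exists lam; split => //; rewrite cost_gaussE// ratio_sum_supported//.
  rewrite -EFinD lee_fin ler_pdivrMr// mulrDl divfK ?gt_eqF//.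
  by rewrite -sqdist_gauss_proj// gt_eqF.
move=> /existsNP[a /not_implyP[wa /eqP va]].
(* Half of the error pays for the tilt, half for the push; the factor [2 * sigma ^+ 2] converts
   [cost] into [sqdist]. *)
have e2 : 0 < e * (2 * sigma ^+ 2) / 2 by rewrite divr_gt0// mulr_gt0.
have [t [/andP[t0 t1] w'v le1]] :=
  @vanishing_gauss_proj w u mu v a _ w0 u0 uv wa va e2.
set w' := _ + _ in w'v le1.
have w'0 b : 0 <= w' b 0.
  by rewrite !mxE addr_ge0// mulr_ge0// ?subr_ge0 ltW.
have S0 := inv_weight_gt0 w'0 w'v v0.
have [||lam [blam lv le]] := @open_halfspace_approx lo hi w mu v
    (gauss_proj w' mu v) _ w0 v1 mv bmu _ _ e2.
- by apply: bproj => //; rewrite t1 ltW.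
- by rewrite dot_gauss_proj// gt_eqF.
exists lam; split => //; rewrite cost_gaussE//.
rewrite (ratio_sum_unsupported _ _ w0 wa va) add0e lee_fin ler_pdivrMr//.
by move: le le1; lra.
Qed.

End Projection.

(** * Characteristic time *)

Section Attainment.

(* An infimum of continuous functions is upper semicontinuous. *)
Lemma compact_max_ereal_inf (R : realType) (T : topologicalType) (J : Type)
    (C : set T) (L : set J) (h : T -> J -> R) :
  compact C -> C !=set0 -> (forall j, L j -> continuous (h ^~ j)) ->
  let G x := ereal_inf [set (h x j)%:E | j in L] in
  exists2 x, C x & forall y, C y -> (G y <= G x)%E.
Proof.
move=> cC [x1 Cx1] hc G; pose M := ereal_sup (G @` C).
have GM y : C y -> (G y <= M)%E.
  by move=> Cy; apply: ereal_sup_ubound; exists y.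
(* If the supremum is -oo there is no level below it to index the filter base, but [G] is then
   constant on [C]. *)
have [MN|MN] := eqVneq M -oo%E.
  exists x1 => // y Cy; have := GM y Cy.
  by rewrite MN leeNy_eq => /eqP ->; rewrite leNye.
(* The strict superlevel sets below the supremum generate a proper filter; a cluster point of it is
   a maximizer. *)
pose B (s : \bar R) := [set y | C y /\ (s < G y)%E].
pose F := filter_from [set s | (s < M)%E] B.
have FF : Filter F.
  apply: filter_from_filter; first by exists -oo%E; rewrite /= ltNye.
  move=> s t sM tM; exists (Order.max s t); first by rewrite /= gt_max sM.
  by move=> y [Cy]; rewrite gt_max => /andP[sG tG]; split; split.
have PF : ProperFilter F.
  apply: filter_from_proper => s /ereal_sup_gt[_ [y Cy <-] sG].
  by exists y; split.
have FC : F C by exists -oo%E; [rewrite /= ltNye|move=> y []].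
have [x [Cx clx]] := cC F PF FC.
exists x => // y Cy; apply: (le_trans (GM y Cy)).
apply/ereal_infP => _ [j Lj <-]; rewrite leNgt; apply/negP => hM.
(* A level [r] separates [h x j] from [M]: near [x] one has [h z j < r], whereas [G > r] on a set of
   the filter. *)
have [r hr rM] : exists2 r : R, h x j < r & (r%:E < M)%E.
  move: hM; case: (M) MN => [m| |] // _.
    rewrite lte_fin => hm; exists ((h x j + m) / 2); rewrite ?lte_fin; lra.
  by exists (h x j + 1); rewrite ?ltry// ltrDl.
have nx : nbhs x [set z | h z j < r].
  apply: (hc j Lj x [set t | t < r]).
  by apply: open_nbhs_nbhs; split => //; exact: open_lt.
have FB : F (B r%:E) by exists r%:E.
have [z [[Cz rG] /= zr]] := clx _ _ FB nx.
have : (G z <= (h z j)%:E)%E by apply: ereal_inf_lbound; exists j.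
by rewrite leNgt => /negP; apply; apply: lt_trans rG; rewrite lte_fin.
Qed.

Context {R : realType} {K : nat}.

Lemma continuous_weights (k : 'I_K -> R) :
  continuous (fun r : 'rV[R]_K => \sum_a r^T a 0 * k a).
Proof.
rewrite (_ : (fun r : 'rV[R]_K => _) = fun r => \sum_a r 0 a * k a); last first.
  by apply/funext => r; apply: eq_bigr => a _; rewrite mxE.
apply: continuous_big => [|a _ r]; first exact: add_continuous.
apply: (@continuous_comp _ _ _ (fun r : 'rV[R]_K => r 0 a) ( *%R^~ (k a))).
  exact: coord_continuous.
exact: mulrr_continuous.
Qed.

(** A finite intersection of closed half-spaces inside the cube [[0, 1]^K]. Row vectors are used
    because [rV_compact] is stated for them. *)
Lemma compact_feasible m (B : 'M[R]_(m, K)) (c : 'cV[R]_m) :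
  compact [set r : 'rV[R]_K | feasible B c r^T].
Proof.
pose I01 := [set r : 'rV[R]_K | forall a, `[0, 1]%classic (r ord0 a)].
have cI : compact I01.
  by apply: (@rV_compact R K (fun=> `[0, 1]%classic)) => a; exact: segment_compact.
apply: subclosed_compact cI _; last first.
  move=> r [[r0 r1] _] a /=; rewrite in_itv/=.
  have := r0 a; rewrite mxE => ra; rewrite ra/= -r1 (bigD1 a)//= mxE lerDl.
  by apply: sumr_ge0 => b _; exact: r0.
rewrite feasible_polyhedron.
rewrite (_ : mkset _ = \bigcap_(i in setT) [set r : 'rV[R]_K |
    \sum_a r^T a 0 * full_lhs B i a <= full_rhs c i 0]); last first.
  apply/seteqP; split => r H i; have := H i.
    by rewrite /= !mxE; under eq_bigr do rewrite mulrC.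
  by move=> /(_ I); rewrite /= !mxE; under eq_bigr do rewrite mulrC.
apply: closed_bigI => i _.
apply: (@preimage_closed _ _ (fun r : 'rV[R]_K => \sum_a r^T a 0 * full_lhs B i a)
  [set y | y <= full_rhs c i 0]).
  by move=> r _; exact: continuous_weights.
exact: closed_le.
Qed.

End Attainment.

(** * From alternative instances to neighbors *)

Section CharacteristicTime.
Context {R : realType} {K m : nat} (B : 'M[R]_(m, K)) (c : 'cV[R]_m).
Context (Pi : set 'cV[R]_K) (lo hi sigma : R) (mu p : 'cV[R]_K).
Context (hPi : Pi = simplex \/ Pi = feasible B c) (sigma_gt0 : 0 < sigma).
Context (box_mu : box lo hi mu) (opt_p : unique_optimal (feasible B c) mu p).

Let sigma_neq0 : sigma != 0. Proof. by rewrite gt_eqF. Qed.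

(** The simplex is the feasible set of a system without rows, so both choices of [Pi] are treated as
    one polytope. *)
Lemma allocation_polytope : exists m' (B' : 'M[R]_(m', K)) c',
  Pi = feasible B' c' /\ feasible B c `<=` Pi.
Proof.
case: hPi => ->; last by exists m, B, c; split.
exists 0%N, (0 : 'M[R]_(0, K)), (0 : 'cV[R]_0); split; last by move=> x [].
by apply/seteqP; split=> [x sx|x [] //]; split=> // i; case: i.
Qed.

Lemma feasible_convex m' (B' : 'M[R]_(m', K)) c' x y (t : R) : 0 <= t <= 1 ->
  feasible B' c' x -> feasible B' c' y ->
  feasible B' c' ((1 - t) *: x + t *: y).
Proof.
rewrite feasible_polyhedron => /andP[t0 t1] Px Py i.
rewrite rowDr !rowZr.
have := ler_wpM2l t0 (Py i).
have t1' : 0 <= 1 - t by rewrite subr_ge0.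
have := ler_wpM2l t1' (Px i); lra.
Qed.

Lemma allocation_ge0 w a : Pi w -> 0 <= w a 0.
Proof. by case: hPi => -> => [[+ _]|[[+ _] _]]; exact. Qed.

Lemma neighbor_feasible q : neighbors B c p q -> feasible B c q.
Proof. by case=> -[]. Qed.

Lemma neighbor_gap q : neighbors B c p q -> 0 < dot mu (p - q).
Proof.
move=> Nq; rewrite dotBr subr_gt0; case: opt_p => _; apply.
  exact: neighbor_feasible.
by case: Nq.
Qed.

Lemma neighbor_neq q : neighbors B c p q -> p - q != 0.
Proof. by case=> _ /eqP qp _; rewrite subr_eq0 eq_sym. Qed.

Lemma neighbor_sum0 q : neighbors B c p q -> \sum_a (p - q) a 0 = 0.
Proof.
move=> /neighbor_feasible[[_ q1] _]; case: opt_p => -[[_ p1] _] _.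
under eq_bigr => a _ do rewrite mxE [X in _ + X]mxE.
by rewrite sumrB p1 q1 subrr.
Qed.

Lemma gauss_proj_argmin (w q : 'cV[R]_K) : (forall a, 0 < w a 0) ->
  neighbors B c p q -> box lo hi (gauss_proj w mu (p - q)) ->
  argmin_on [set lam | box lo hi lam /\ dot lam (p - q) <= 0]
    (cost (kl_gauss sigma) w mu) (gauss_proj w mu (p - q)).
Proof.
move=> w0 Nq bproj.
have w0' a : 0 <= w a 0 by rewrite ltW.
have wv : supported w (p - q) by move=> a wa; have := w0 a; rewrite wa ltxx.
have v0 := neighbor_neq Nq.
have S0 : inv_weight w (p - q) != 0 by rewrite gt_eqF// inv_weight_gt0.
split; first by split => //; rewrite dot_gauss_proj.
move=> lam [_ lv]; rewrite cost_gaussE// sqdist_gauss_proj//.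
rewrite -ratio_sum_supported//; apply: ratio_sum_le_cost => //.
by rewrite ltW// neighbor_gap.
Qed.

Let alt := alternatives (box lo hi) (feasible B c) p.

Lemma alternativesE lam : alt lam <->
  box lo hi lam /\ exists2 q, neighbors B c p q & dot lam (p - q) < 0.
Proof.
split=> -[blam].
  move=> /ereal_sup_gt[_ [x Fx <-]]; rewrite lte_fin => lx; split => //.
  have [q Nq lq] := neighbor_improving opt_p Fx lx.
  by exists q => //; rewrite dotBr subr_lt0.
move=> [q Nq]; rewrite dotBr subr_lt0 => lq; split => //.
apply: (@lt_le_trans _ _ (dot lam q)%:E); first by rewrite lte_fin.
by apply: ereal_sup_ubound; exists q => //; exact: neighbor_feasible.
Qed.

Context (box_proj : forall w q, Pi w -> neighbors B c p q ->
  (forall a, w a 0 = 0 -> (p - q) a 0 = 0) ->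
  box lo hi (gauss_proj w mu (p - q))).

(** Each alternative violates optimality against some neighbor, which bounds its cost below by
    [ratio_sum_le_cost]; conversely [ratio_sum_approx] gives alternatives with cost within any [e]
    of each ratio. *)
Lemma inf_cost_neighbors w : Pi w ->
  ereal_inf [set cost (kl_gauss sigma) w mu lam | lam in alt] =
  ereal_inf [set ratio_sum sigma mu w (p - q) | q in neighbors B c p].
Proof.
move=> Piw; have w0 a := allocation_ge0 a Piw.
apply/eqP; rewrite eq_le; apply/andP; split; last first.
  apply/ereal_infP => _ [lam /alternativesE[blam [q Nq lq]] <-].
  apply: (@le_trans _ _ (ratio_sum sigma mu w (p - q))).
    by apply: ereal_inf_lbound; exists q.
  apply: ratio_sum_le_cost => //; last exact: ltW.
    exact: neighbor_neq.
  by rewrite ltW// neighbor_gap.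
apply/ereal_infP => _ [q Nq <-]; apply/lee_addgt0Pr => e e0.
have [m' [B' [c' [PiE FPi]]]] := allocation_polytope.
have [Fp _] := opt_p; have Fq := neighbor_feasible Nq.
(* As [p] and [q] are non-negative, their midpoint is positive wherever they differ; it lies in [Pi]
   by convexity of the feasible set. *)
pose u := (1 - 1 / 2) *: p + (1 / 2) *: q.
have Piu : Pi u.
  by apply: FPi; apply: feasible_convex => //; apply/andP; split; lra.
have uE a : u a 0 = (p a 0 + q a 0) / 2 by rewrite !mxE; field.
have [p0 q0] : (forall a, 0 <= p a 0) /\ (forall a, 0 <= q a 0).
  by case: Fp Fq => -[? _] _ [[? _] _].
have uv a : (p - q) a 0 != 0 -> 0 < u a 0.
  rewrite uE => pq; rewrite divr_gt0// lt_neqAle addr_ge0// andbT eq_sym.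
  apply: contra pq; rewrite paddr_eq0// => /andP[/eqP pa /eqP qa].
  by rewrite !mxE pa qa subrr.
have [|lam [blam lv le]] := @ratio_sum_approx _ _ sigma lo hi w u mu (p - q) e
    sigma_neq0 w0 (fun a => allocation_ge0 a Piu) uv _ box_mu (neighbor_sum0 Nq)
    (neighbor_gap Nq) e0.
  (* Tilted allocations remain in the convex set [Pi], so [box_proj] applies to them. *)
  move=> t w' /andP[t0 t1] w'v; apply: box_proj => //.
  move: Piw Piu; rewrite PiE /w' => Piw Piu; apply: feasible_convex => //.
  by rewrite t0 ltW.
apply: le_trans le; apply: ereal_inf_lbound; exists lam => //.
by apply/alternativesE; split => //; exists q.
Qed.

Lemma max_inf_cost : exists2 w, Pi w & forall w', Pi w' ->
  (ereal_inf [set cost (kl_gauss sigma) w' mu lam | lam in alt] <=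
   ereal_inf [set cost (kl_gauss sigma) w mu lam | lam in alt])%E.
Proof.
have [m' [B' [c' [PiE FPi]]]] := allocation_polytope.
have Cne : [set r : 'rV[R]_K | feasible B' c' r^T] !=set0.
  exists p^T; rewrite /= trmxK -PiE; apply: FPi.
  by case: opt_p.
(* For fixed [lam] the cost is linear in the allocation, hence continuous. *)
pose h (r : 'rV[R]_K) lam := sqdist r^T mu lam / (2 * sigma ^+ 2).
have hc lam : continuous (h ^~ lam).
  rewrite (_ : h ^~ lam = fun r : 'rV[R]_K => \sum_a r^T a 0 *
    ((mu a 0 - lam a 0) ^+ 2 / (2 * sigma ^+ 2))); last first.
    apply/funext => r; rewrite /h /sqdist mulr_suml.
    by apply: eq_bigr => a _; rewrite mulrA.
  exact: continuous_weights.
have [r Cr rmax] := @compact_max_ereal_inf R _ _ _ alt h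
  (@compact_feasible _ _ _ B' c') Cne (fun lam _ => hc lam).
have costE w : [set cost (kl_gauss sigma) w mu lam | lam in alt] =
    [set (h w^T lam)%:E | lam in alt].
  by apply: eq_imagel => lam _; rewrite cost_gaussE// /h trmxK.
exists r^T; first by rewrite PiE.
move=> w'; rewrite PiE !costE trmxK => Piw'; apply: rmax.
by rewrite /= trmxK.
Qed.

Lemma char_time_maxmin :
  maxmin_on Pi (neighbors B c p) (fun w q => ratio_sum sigma mu w (p - q))
    ((char_time (kl_gauss sigma) (box lo hi) (feasible B c) Pi mu p)^-1)%E.
Proof.
split.
  move=> w _; apply: (@min_on_extreme _ _ _ (full_lhs B) (full_rhs c)).
  by move=> q [xq _ _]; rewrite -feasible_polyhedron.
rewrite /char_time inveK; have [w Piw wmax] := max_inf_cost.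
have -> : ereal_sup [set ereal_inf
      [set cost (kl_gauss sigma) w mu lam | lam in alt] | w in Pi] =
    ereal_inf [set cost (kl_gauss sigma) w mu lam | lam in alt].
  apply/eqP; rewrite eq_le; apply/andP; split.
    by apply/ereal_supP => _ [w' Piw' <-]; exact: wmax.
  by apply: ereal_sup_ubound; exists w.
split; first by exists w => //; rewrite inf_cost_neighbors.
by move=> w' Piw'; rewrite -inf_cost_neighbors//; exact: wmax.
Qed.

End CharacteristicTime.

Theorem theorem2 (R : realType) (K m : nat)
    (B : 'M[R]_(m, K)) (c : 'cV[R]_m) (Pi : set 'cV[R]_K)
    (mu_min mu_max sigma : R) (mu pistar : 'cV[R]_K)
    (hPi : Pi = simplex \/ Pi = feasible B c)
    (hsigma : 0 < sigma)
    (hmu : box mu_min mu_max mu)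
    (hopt : unique_optimal (feasible B c) mu pistar) :
  (forall w pi', Pi w -> (forall a, 0 < w a 0) ->
     neighbors B c pistar pi' ->
     box mu_min mu_max (gauss_proj w mu (pistar - pi')) ->
     argmin_on
       [set lam | box mu_min mu_max lam /\ dot lam (pistar - pi') <= 0]
       (cost (kl_gauss sigma) w mu)
       (gauss_proj w mu (pistar - pi')))
  /\
  ((forall w pi', Pi w -> neighbors B c pistar pi' ->
      (forall a, w a 0 = 0 -> (pistar - pi') a 0 = 0) ->
      box mu_min mu_max (gauss_proj w mu (pistar - pi'))) ->
   let T := char_time (kl_gauss sigma) (box mu_min mu_max) (feasible B c) Pi
              mu pistar in
   maxmin_on Pi (neighbors B c pistar)
     (fun w pi' => ratio_sum sigma mu w (pistar - pi')) (T^-1)%E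
   /\
   maxmin_on Pi (neighbors B c pistar)
     (fun w pi' => ratio_norm sigma mu w (pistar - pi')) (T^-1)%E).
Proof.
split=> [w pi' Piw w0 Nq bproj|box_proj T]; 
  first exact: (gauss_proj_argmin hsigma hopt).
have maxmin := char_time_maxmin hPi hsigma hmu hopt box_proj.
split=> //; rewrite (_ : (fun w q => ratio_norm _ _ _ _) =
  fun w q => ratio_sum sigma mu w (pistar - q))//.
by apply/funext => w; apply/funext => q; exact: ratio_norm_sum.
Qed.
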